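(* Consider the model of the context. Assume that $p(\theta)$ is a proper prior distribution, and that there exists a sequence of axis-aligned rectangles $R_{n_0}\subseteq\mathbb{R}^d$ such that $p_{n_0}:=P(s\in R_{n_0}\mid n=n_0)$ satisfies both $p_{n_0}>0$ and $\mathrm{KS}_{n_0}/p_{n_0}\to0$ as $n_0\to\infty$, where $\mathrm{KS}_{n_0}=\mathrm{KS}\big(p(s,\theta\mid n=n_0),\,p(s,\theta\mid n_{\mathrm{dp}}=n_0)\big)$. Suppose further that there exist $b'>0$, a sequence $\theta_{n_0}$, and a random variable $Y$ with continuous cdf $F_Y$ such that $$n_0^{b'}(\theta-\theta_{n_0})\,\big|\,(n=n_0,\ s\in R_{n_0})\ \overset{d}{\to}\ Y\qquad(n_0\to\infty).$$ Then also $$n_0^{b'}(\theta-\theta_{n_0})\,\big|\,(n_{\mathrm{dp}}=n_0,\ s\in R_{n_0})\ \overset{d}{\to}\ Y .$$ Equivalently, $\mathrm{KS}\big(p(n_0^{b'}(\theta-\theta_{n_0})\mid n=n_0,s\in R_{n_0}),\;p(n_0^{b'}(\theta-\theta_{n_0})\mid n_{\mathrm{dp}}=n_0,s\in R_{n_0})\big)\to0$.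
   Context: For probability measures $P,Q$ on a Euclidean space, $\mathrm{KS}(P,Q)=\sup_R|P(R)-Q(R)|$ over axis-aligned rectangles $R$. We write $p(\cdot\mid\cdot)$ both for a (conditional) density/pmf and for the corresponding distribution. Model: $\theta\in\Theta\subseteq\mathbb{R}^p$ is a parameter with prior $p(\theta)$; $n\in\{1,2,\dots\}$ is the unobserved sample size with a (possibly improper) prior $p(n)$ for which the posterior $p(n\mid n_{\mathrm{dp}})$ is proper, $\theta$ and $n$ being a priori independent; given $(\theta,n)$ the sensitive dataset $x$ of size $n$ has distribution $p(x\mid\theta,n)$; the privatized summary $s\in\mathbb{R}^d$ is drawn from $p(s\mid x)$, and the privatized sample size $n_{\mathrm{dp}}\in\mathbb{R}$ is drawn from $p(n_{\mathrm{dp}}\mid n)$. Given $(x,n)$, $s$ and $n_{\mathrm{dp}}$ are conditionally independent; given $n$, $n_{\mathrm{dp}}$ is independent of $(x,\theta)$; given $x$, $s$ is independent of $\theta$. Thus $p(s,\theta\mid n)=p(\theta)\int p(s\mid x)p(x\mid\theta,n)\,dx$ and $p(s,\theta\mid n_{\mathrm{dp}})=\sum_{k\ge1}p(s,\theta\mid n=k)\,p(n=k\mid n_{\mathrm{dp}})$. *)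

(* Defs.v *)
From HB Require Import structures.
From mathcomp Require Import all_boot all_order all_algebra.
From mathcomp Require Import all_classical all_reals all_analysis.
Import Order.TTheory GRing.Theory Num.Theory.
Import numFieldNormedType.Exports.

Set Implicit Arguments.
Unset Strict Implicit.
Unset Printing Implicit Defensive.

Local Open Scope classical_set_scope.
Local Open Scope ring_scope.
Local Open Scope ereal_scope.

(* R^m is 'rV[R]_m, with the Borel sigma-algebra of its usual topology. *)
HB.instance Definition _ (R : realType) (m : nat) :=
  @isMeasurable.Build (sigma_display (@open 'rV[R]_m)) 'rV[R]_m
    <<s @open 'rV[R]_m >>
    (@sigma_algebra0 _ setT (@open 'rV[R]_m))
    (@sigma_algebraC _ (@open 'rV[R]_m))
    (@sigma_algebra_bigcup _ setT (@open 'rV[R]_m)).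

Section KolmogorovSmirnov.
Context {R : realType} {m : nat}.

(* Each side is an arbitrary interval: open or closed at either end, possibly
   unbounded or empty. *)
Definition rectangle (A : set 'rV[R]_m) : Prop :=
  exists I : 'I_m -> interval R, A = [set x | forall i, x 0%R i \in I i].

Definition KS (P Q : set 'rV[R]_m -> \bar R) : \bar R :=
  ereal_sup [set `|P A - Q A| | A in rectangle].

Definition mcdf (P : set 'rV[R]_m -> \bar R) (y : 'rV[R]_m) : \bar R :=
  P [set x | forall i, (x 0%R i <= y 0%R i)%R].

(* Convergence in distribution: the distribution functions converge at every
   continuity point of the limiting one. *)
Definition cvg_distr (P : nat -> set 'rV[R]_m -> \bar R)
    (Q : set 'rV[R]_m -> \bar R) : Prop :=
  forall y, {for y, continuous (mcdf Q)} ->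
    mcdf (P k) y @[k --> \oo] --> mcdf Q y.

End KolmogorovSmirnov.

(* Points of R^(d + p) are pairs (s, theta), encoded as row_mx s theta. *)
Section Conditioning.
Context {R : realType} {d p : nat}.

Definition prob_s (P : set 'rV[R]_(d + p) -> \bar R) (S : set 'rV[R]_d) :
    \bar R :=
  P [set w | S (lsubmx w)].

(* The law of f theta given s \in S, when (s, theta) has law P. *)
Definition cond_law (P : set 'rV[R]_(d + p) -> \bar R) (S : set 'rV[R]_d)
    (f : 'rV[R]_p -> 'rV[R]_p) (B : set 'rV[R]_p) : \bar R :=
  P [set w | S (lsubmx w) /\ B (f (rsubmx w))] / prob_s P S.

Definition rescale (b : R) (k : nat) (c t : 'rV[R]_p) : 'rV[R]_p :=
  ((k%:R `^ b) *: (t - c))%R.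

End Conditioning.

Section PosteriorSampleSize.
Context {R : realType}.
(* w k is the prior weight of n = k, with no summability requirement, and
   g k is the density of n_dp given n = k; only k >= 1 is used. *)
Variables (w : nat -> R) (g : nat -> R -> R).

Definition evidence (v : R) : \bar R :=
  \sum_(1 <= k <oo) (w k * g k v)%:E.

Definition posterior (v : R) (k : nat) : \bar R :=
  (w k * g k v)%:E / evidence v.

End PosteriorSampleSize.

(* The hierarchical model with joint law
     w(n) prior(dtheta) px(dx | theta, n) ps(ds | x) g(n_dp | n),
   whose factorisation encodes the independence of theta and n and the
   conditional independences. X k is the space of datasets of size k. *)
Section Model.
Context {R : realType} {d p : nat} {dX : measure_display}.
Variables (X : nat -> measurableType dX).
Variables (prior : probability 'rV[R]_p R).
Variables (px : forall k, R.-pker 'rV[R]_p ~> X k).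
Variables (ps : forall k, R.-pker X k ~> 'rV[R]_d).

(* The law of (s, theta) given n = k. *)
Definition law_given_n (k : nat) (A : set 'rV[R]_(d + p)) : \bar R :=
  \int[prior]_t \int[px k t]_x ps k x [set s | A (row_mx s t)].

(* The law of (s, theta) given n_dp = v. *)
Definition law_given_ndp (w : nat -> R) (g : nat -> R -> R) (v : R)
    (A : set 'rV[R]_(d + p)) : \bar R :=
  \sum_(1 <= k <oo) law_given_n k A * posterior w g v k.

End Model.

(* Main.v *)
(* The event {s \in S, theta \in B} is a rectangle in (s, theta)-space whenever
   S and B are rectangles, and rescaling theta maps rectangles to rectangles.
   So with P, Q the laws given n = k and n_dp = k, both the numerators and the
   denominators of the two conditional laws differ by at most K = KS P Q, and
   |a / x - a' / y| <= |a - a'| / x + (a' / y) * |x - y| / x <= 2 * K / x,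
   where x = P(s \in S) and a' <= y.  This is 2 KS_{n0} / p_{n0} -> 0. *)
Require Import Defs.
From HB Require Import structures.
From mathcomp Require Import all_boot all_order all_algebra.
From mathcomp Require Import all_classical all_reals all_analysis.
From mathcomp Require Import ring lra.
Import Order.TTheory GRing.Theory Num.Theory.
Import numFieldNormedType.Exports.
Local Open Scope classical_set_scope.
Local Open Scope ring_scope.
Local Open Scope ereal_scope.

(** * Stability and measurability of rectangles *)

Lemma rectangle_setT {R : realType} {m : nat} : rectangle [set: 'rV[R]_m].
Proof.
by exists (fun=> `]-oo, +oo[); apply/seteqP; split => x // _ i.
Qed.

Lemma rectangle_lower {R : realType} {m : nat} (y : 'rV[R]_m) :
  rectangle [set x : 'rV[R]_m | forall i, (x 0%R i <= y 0%R i)%R].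
Proof.
exists (fun i => `]-oo, y 0%R i]%R).
by apply/seteqP; split => x /= xy i; move: (xy i); rewrite in_itv.
Qed.

Lemma rectangle_row {R : realType} {d p : nat} (S : set 'rV[R]_d)
    (B : set 'rV[R]_p) : rectangle S -> rectangle B ->
  rectangle [set w : 'rV[R]_(d + p) | S (lsubmx w) /\ B (rsubmx w)].
Proof.
move=> [I ->] [J ->].
have splitl i : fintype.split (lshift p i) = inl i := unsplitK (inl i).
have splitr j : fintype.split (rshift d j) = inr j := unsplitK (inr j).
(* The first [d] coordinates take their sides from [S], the last [p] from [B]. *)
exists (fun k => match fintype.split k with inl i => I i | inr j => J j end).
apply/seteqP; split => w /= => [[wI wJ] k|wIJ].
  have [i ->|j ->] := split_ordP k.
    by move: (wI i); rewrite mxE.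
  by move: (wJ j); rewrite mxE.
split => i; rewrite mxE.
  by move: (wIJ (lshift p i)); rewrite splitl.
by move: (wIJ (rshift d i)); rewrite splitr.
Qed.

(** Since [a > 0], the inverse map [y / a + c] is increasing: it carries endpoints to endpoints,
    keeps each open or closed, and leaves infinite bounds in place. *)
Lemma itv_preimage_affine {R : realType} (a c : R) (I : interval R) :
  (0 < a)%R -> exists J : interval R,
    forall x, (x \in J) = ((a * (x - c))%R \in I).
Proof.
move=> a0; pose f (e : itv_bound R) :=
  match e with BSide s y => BSide s (y / a + c)%R | BInfty s => BInfty R s end.
have le_inv x y : ((y / a + c <= x) = (y <= a * (x - c)))%R.
  by rewrite -lerBrDr ler_pdivrMr// mulrC.
have ge_inv x y : ((x <= y / a + c) = (a * (x - c) <= y))%R.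
  by rewrite -lerBlDr ler_pdivlMr// mulrC.
have lt_inv x y : ((y / a + c < x) = (y < a * (x - c)))%R.
  by rewrite !ltNge ge_inv.
have gt_inv x y : ((x < y / a + c) = (a * (x - c) < y))%R.
  by rewrite !ltNge le_inv.
case: I => l r; exists (Interval (f l) (f r)) => x.
rewrite !itv_boundlr; congr andb.
  by case: l => [[] ?|[]]; rewrite /= ?bnd_simp ?le_inv ?lt_inv.
by case: r => [[] ?|[]]; rewrite /= ?bnd_simp ?ge_inv ?gt_inv.
Qed.

Lemma rectangle_rescale {R : realType} {p : nat} (b : R) (k : nat)
    (c : 'rV[R]_p) (B : set 'rV[R]_p) : (0 < k)%N -> rectangle B ->
  rectangle (rescale b k c @^-1` B).
Proof.
move=> k0 [I ->].
have a0 : (0 < k%:R `^ b :> R)%R by rewrite powR_gt0// ltr0n.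
have /choice [J JI] i := itv_preimage_affine _ (c 0%R i) (I i) a0.
exists J; apply/seteqP; split => t /= tI i; move: (tI i);
  by rewrite JI /rescale !mxE.
Qed.

Lemma measurable_rectangle {R : realType} {m : nat} (A : set 'rV[R]_m) :
  rectangle A -> measurable A.
Proof.
move=> [I ->].
rewrite [X in measurable X](_ : _ =
    \bigcap_(i in [set: 'I_m]) (fun x : 'rV[R]_m => x 0%R i) @^-1` [set` I i]).
  2: by apply/seteqP; split => x /= xI i; [move=> _|]; exact: xI.
apply: fin_bigcap_measurable => // i _; rewrite -[X in measurable X]setTI.
have mcoord : measurable_fun [set: 'rV[R]_m]
    ((fun x : 'rV[R]_m => x 0%R i) : _ -> measurableTypeR R).
  (* It suffices to pull back open intervals, and coordinates are continuous. *)
  apply: (measurability _ (measurable_realfun.RGenOpens.measurableE R)).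
  move=> _ [_ [a [b ->] <-]]; rewrite setTI; apply: sub_sigma_algebra.
  have /continuousP := @coord_continuous R 1 m 0%R i.
  by apply; exact: interval_open.
apply: mcoord => //; exact: measurable_itv.
Qed.

(** * Positivity, monotonicity and total mass of the two laws *)

(** The integral of a nonnegative function is a supremum over the simple functions below it, so
    enlarging the function enlarges the family; no measurability is involved. *)
Lemma ge0_le_integralT d (T : measurableType d) (R : realType)
    (mu : {measure set T -> \bar R}) (f1 f2 : T -> \bar R) :
  (forall x, 0 <= f1 x) -> (forall x, f1 x <= f2 x) ->
  \int[mu]_x f1 x <= \int[mu]_x f2 x.
Proof.
move=> f10 f12; have f20 x : 0 <= f2 x by exact: le_trans (f12 x).
rewrite !ge0_integralTE//; apply: ge_ereal_sup => _ [h /= hf1 <-].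
apply: ereal_sup_ubound; exists h => //= x.
exact: le_trans (f12 x).
Qed.

Section laws.
Context {R : realType} {d p : nat} {dX : measure_display}.
Variables (X : nat -> measurableType dX).
Variables (prior : probability 'rV[R]_p R).
Variables (px : forall k, R.-pker 'rV[R]_p ~> X k).
Variables (ps : forall k, R.-pker X k ~> 'rV[R]_d).
Variables (w : nat -> R) (g : nat -> R -> R).
Hypothesis w_ge0 : forall k, (0 < k)%N -> (0 <= w k)%R.
Hypothesis g_ge0 : forall k v, (0 < k)%N -> (0 <= g k v)%R.

Local Notation law k := (law_given_n prior px ps k).
Local Notation lawdp v := (law_given_ndp prior px ps w g v).

Lemma law_given_n_ge0 k A : 0 <= law k A.
Proof. by apply: integral_ge0 => t _; apply: integral_ge0. Qed.

Lemma le_law_given_n k A A' :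
  (forall x t, ps k x [set s | A (row_mx s t)] <=
               ps k x [set s | A' (row_mx s t)]) ->
  law k A <= law k A'.
Proof.
move=> AA'; apply: ge0_le_integralT => t; first exact: integral_ge0.
exact: ge0_le_integralT.
Qed.

Lemma law_given_n_setT k : law k setT = 1.
Proof.
rewrite /law_given_n; under eq_integral => t _.
  under eq_integral => x _ do rewrite prob_kernel.
  rewrite integral_cst// mul1e prob_kernel.
  over.
by rewrite integral_cst// mul1e; exact: probability_setT.
Qed.

Lemma prob_s_law_le1 k S : rectangle S -> prob_s (law k) S <= 1.
Proof.
move=> /measurable_rectangle mS; rewrite -(law_given_n_setT k).
apply: le_law_given_n => x t; rewrite -[leRHS]/(ps k x setT).
(* The cylinder over [S] has slice [S] at every [t]. *)
rewrite [X in ps k x X <= _](_ : _ = S); last first.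
  by apply/seteqP; split => s; rewrite /= row_mxKl.
by apply: le_measure; rewrite ?inE.
Qed.

(* Every slice of the left-hand set is either S or empty, so that monotonicity
   holds for non-measurable sets too. *)
Lemma law_given_n_le_prob_s k S B :
  law k [set u | S (lsubmx u) /\ B (rsubmx u)] <= prob_s (law k) S.
Proof.
apply: le_law_given_n => x t.
have [Bt|Bt] := pselect (B t).
  rewrite le_eqVlt; apply/orP; left; apply/eqP; congr (ps k x _).
  by apply/seteqP; split => s /=; rewrite row_mxKl row_mxKr => // -[].
rewrite [X in ps k x X <= _](_ : _ = set0) ?measure0//.
by apply/seteqP; split => s //=; rewrite row_mxKr => -[].
Qed.

Section ndp.
Variables (v : R).
Hypothesis ev : 0 < evidence w g v < +oo.

Lemma posterior_ge0 k : (0 < k)%N -> 0 <= posterior w g v k.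
Proof.
move=> k0; rewrite mule_ge0//; last by rewrite inve_ge0 ltW//; case/andP: ev.
by rewrite lee_fin mulr_ge0// ?w_ge0// g_ge0.
Qed.

Lemma sum_posterior : \sum_(1 <= k <oo) posterior w g v k = 1.
Proof.
have /andP[e0 eoo] := ev.
have efin : evidence w g v \is a fin_num by rewrite ge0_fin_numE// ltW.
rewrite /posterior; under eq_eseriesr do rewrite muleC.
rewrite -(fineK efin) inver gt_eqF ?fine_gt0//.
(* Moving the bound [1 <= k] into the condition lets the signs of [w] and [g] be used for positive
   [k] only. *)
rewrite eseries_cond nneseriesZl.
  2: by move=> k /= k0; rewrite lee_fin mulr_ge0// ?w_ge0// g_ge0.
rewrite -eseries_cond -[X in _ * X]/(evidence w g v) -[X in _ * X](fineK efin).
by rewrite -EFinM mulVf// gt_eqF// fine_gt0.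
Qed.

Lemma law_given_ndp_ge0 A : 0 <= lawdp v A.
Proof.
apply: nneseries_ge0 => k k0 _.
by rewrite mule_ge0 ?posterior_ge0 ?law_given_n_ge0.
Qed.

Lemma le_law_given_ndp A A' :
  (forall k, law k A <= law k A') -> lawdp v A <= lawdp v A'.
Proof.
move=> AA'; rewrite /law_given_ndp eseries_cond [leRHS]eseries_cond.
apply: lee_nneseries => k /=.
  by move=> _ k0; rewrite mule_ge0 ?posterior_ge0 ?law_given_n_ge0.
by move=> k0; rewrite lee_wpmul2r ?posterior_ge0.
Qed.

Lemma prob_s_lawdp_le1 S : rectangle S -> prob_s (lawdp v) S <= 1.
Proof.
move=> rS; rewrite [leRHS](_ : _ = lawdp v setT).
  apply: le_law_given_ndp => k.
  by rewrite law_given_n_setT; exact: prob_s_law_le1.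
(* Each component of the mixture has mass 1, so the total mass is that of the posterior weights. *)
rewrite -sum_posterior; apply: eq_eseriesr => k _.
by rewrite law_given_n_setT mul1e.
Qed.

Lemma law_given_ndp_le_prob_s S B :
  lawdp v [set u | S (lsubmx u) /\ B (rsubmx u)] <= prob_s (lawdp v) S.
Proof. by apply: le_law_given_ndp => k; exact: law_given_n_le_prob_s. Qed.

End ndp.
End laws.

(** * Comparison of conditional laws through [KS] *)

Lemma KS_ge {R : realType} {m : nat} (P Q : set 'rV[R]_m -> \bar R) A :
  rectangle A -> `|P A - Q A| <= KS P Q.
Proof. by move=> rA; apply: ereal_sup_ubound; exists A. Qed.

Lemma KS_ge0 {R : realType} {m : nat} (P Q : set 'rV[R]_m -> \bar R) :
  0 <= KS P Q.
Proof. exact: le_trans (abse_ge0 _) (KS_ge _ _ _ rectangle_setT). Qed.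

Lemma ler_dist_ratio {R : realFieldType} (a p a' p' K : R) :
  (0 < p -> 0 <= a' <= p' -> K < p -> `|a - a'| <= K -> `|p - p'| <= K ->
  `|a / p - a' / p'| <= 2 * (K / p))%R.
Proof.
move=> p0 /andP[a'0 a'p'] Kp aK pK.
(* Indeed [p' >= p - K > 0]. *)
have p'0 : (0 < p')%R by move: pK; rewrite ler_norml => /andP[_]; lra.
rewrite [X in `|X|%R](_ : _ = ((a - a') + (a' / p') * (p' - p)) / p)%R;
  last by field; rewrite !gt_eqF.
rewrite normrM (gtr0_norm (x := p^-1)) ?invr_gt0// mulrA ler_pM2r ?invr_gt0//.
rewrite (le_trans (ler_normD _ _))// mulrDl !mul1r lerD// normrM distrC.
(* The factor [a' / p'] lies between 0 and 1. *)
rewrite -[leRHS]mul1r ler_pM// ger0_norm ?divr_ge0 ?(ltW p'0)//.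
by rewrite ler_pdivrMr// mul1r.
Qed.

(** The ratio being below 1 makes [KS P Q] finite and forces [prob_s Q S > 0], so that both
    quotients are quotients of reals and [ler_dist_ratio] applies. *)
Lemma KS_cond_law_le {R : realType} {d p : nat}
    (P Q : set 'rV[R]_(d + p) -> \bar R) (S : set 'rV[R]_d)
    (f : 'rV[R]_p -> 'rV[R]_p) :
  rectangle S -> (forall B, rectangle B -> rectangle (f @^-1` B)) ->
  (forall B, 0 <= P [set u | S (lsubmx u) /\ B (rsubmx u)] <= prob_s P S) ->
  (forall B, 0 <= Q [set u | S (lsubmx u) /\ B (rsubmx u)] <= prob_s Q S) ->
  0 < prob_s P S < +oo -> prob_s Q S < +oo ->
  KS P Q / prob_s P S < 1 ->
  KS (cond_law P S f) (cond_law Q S f) <= 2%:E * (KS P Q / prob_s P S).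
Proof.
move=> rS rf PS QS /andP[pP0 pPoo] pQoo.
have KSS : `|prob_s P S - prob_s Q S| <= KS P Q.
  apply: KS_ge.
  rewrite [X in rectangle X](_ : _ =
      [set u : 'rV[R]_(d + p) | S (lsubmx u) /\ [set: 'rV[R]_p] (rsubmx u)]).
    exact: (rectangle_row S setT rS rectangle_setT).
  by apply/seteqP; split => u //= -[].
have KSB B : rectangle B ->
    `|P [set u | S (lsubmx u) /\ B (f (rsubmx u))] -
      Q [set u | S (lsubmx u) /\ B (f (rsubmx u))]| <= KS P Q.
  by move=> /rf rB; apply: KS_ge; exact: (rectangle_row S (f @^-1` B)).
have pQ0 : 0 <= prob_s Q S by have /andP[Q0] := QS setT; exact: le_trans.
have := KS_ge0 P Q; case: (KS P Q) KSS KSB => [K KSS KSB K0|_ _ _|//]; last first.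
  (* An infinite [KS P Q] would make the ratio infinite. *)
  by rewrite gt0_mulye ?inve_gt0 ?(gt_eqF pP0) ?(lt_eqF pPoo)// ltNge leey.
have pPfin : prob_s P S \is a fin_num by rewrite ge0_fin_numE// ltW.
have pQfin : prob_s Q S \is a fin_num by rewrite ge0_fin_numE.
move=> KP; apply: ge_ereal_sup => _ [B rB <-]; rewrite /cond_law.
have := KSB _ rB; have /andP[] := PS (f @^-1` B); have /andP[] := QS (f @^-1` B).
rewrite /preimage /=.
set a := P _; set a' := Q _ => a'0 a'Q a0 aP aK.
have afin : a \is a fin_num by rewrite ge0_fin_numE//; exact: le_lt_trans pPoo.
have a'fin : a' \is a fin_num.
  by rewrite ge0_fin_numE//; exact: le_lt_trans pQoo.
move: pP0 pQ0 KSS KP a0 a'0 aP a'Q aK.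
rewrite -(fineK pPfin) -(fineK pQfin) -(fineK afin) -(fineK a'fin).
move: (fine (prob_s P S)) (fine (prob_s Q S)) (fine a) (fine a') => x y r r'.
rewrite !lte_fin -!EFinB !abse_EFin => x0 _; rewrite !lee_fin => xyK.
rewrite !inver gt_eqF// -!EFinM lte_fin ltr_pdivrMr// mul1r.
move=> Kx _ r'0 _ r'y rK.
have y0 : (0 < y)%R by move: xyK; rewrite ler_norml => /andP[_]; lra.
rewrite gt_eqF// -EFinM -EFinB lee_fin; apply: ler_dist_ratio => //.
by rewrite r'0.
Qed.

(** As [l] is finite, [u n] is eventually finite, and then [u n - (u n - v n) = v n] even for
    infinite [v n]. *)
Lemma cvge_abse_sub0 {R : realType} (u v : (\bar R)^nat) (l : \bar R) :
  l \is a fin_num -> u @ \oo --> l -> `|u n - v n| @[n --> \oo] --> 0 ->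
  v @ \oo --> l.
Proof.
case: l => // l _ ul /cvg_abse0P uv0; have /fine_cvgP[ufin _] := ul.
have vE : \forall n \near \oo, u n - (u n - v n) = v n.
  near=> n; have : u n \is a fin_num by near: n.
  case: (u n) (v n) => // r [r'||]// _.
  by rewrite -!EFinB; congr EFin; lra.
apply: cvg_trans (near_eq_cvg vE) _; rewrite -[l%:E]sube0.
by apply: cvgeB => //; rewrite fin_num_adde_defl.
Unshelve. all: by end_near. Qed.

(** * Passage to the limit *)

Theorem theorem3p3 (R : realType) (d p : nat)
  (* parameter space and proper prior *)
  (Theta : set 'rV[R]_p) (mTheta : measurable Theta)
  (prior : probability 'rV[R]_p R) (prior_Theta : prior Theta = 1)
  (* possibly improper prior on the sample size n >= 1 *)
  (w : nat -> R) (w_ge0 : forall k, (0 < k)%N -> (0 <= w k)%R)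
  (* dataset given (theta, n), and privatized summary given the dataset *)
  (dX : measure_display) (X : nat -> measurableType dX)
  (px : forall k, R.-pker 'rV[R]_p ~> X k)
  (ps : forall k, R.-pker X k ~> 'rV[R]_d)
  (* privatized sample size given n: densities with respect to nu *)
  (nu : {sigma_finite_measure set (measurableTypeR R) -> \bar R})
  (g : nat -> R -> R)
  (g_meas : forall k, (0 < k)%N ->
    measurable_fun [set: measurableTypeR R] (g k))
  (g_ge0 : forall k v, (0 < k)%N -> (0 <= g k v)%R)
  (g_int : forall k, (0 < k)%N -> \int[nu]_v (g k v)%:E = 1)
  (* the posterior of n given n_dp = n0 is proper *)
  (g_proper : forall n0 : nat, (0 < n0)%N -> 0 < evidence w g n0%:R < +oo)
  (* rectangles R_{n0} *)
  (S : nat -> set 'rV[R]_d)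
  (S_rect : forall n0, (0 < n0)%N -> rectangle (S n0))
  (S_pos : forall n0, (0 < n0)%N -> 0 < prob_s (law_given_n prior px ps n0) (S n0))
  (S_KS : KS (law_given_n prior px ps n0)
             (law_given_ndp prior px ps w g n0%:R)
          / prob_s (law_given_n prior px ps n0) (S n0) @[n0 --> \oo] --> 0)
  (* limit given the true sample size *)
  (b : R) (b_gt0 : (0 < b)%R) (theta : nat -> 'rV[R]_p)
  (dO : measure_display) (Omega : measurableType dO) (PY : probability Omega R)
  (Y : {RV PY >-> 'rV[R]_p})
  (Y_cont : continuous (mcdf (distribution PY Y)))
  (cvg_n : cvg_distr
    (fun n0 => cond_law (law_given_n prior px ps n0) (S n0)
                 (rescale b n0 (theta n0)))
    (distribution PY Y)) :
  cvg_distr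
    (fun n0 => cond_law (law_given_ndp prior px ps w g n0%:R) (S n0)
                 (rescale b n0 (theta n0)))
    (distribution PY Y)
  /\
  KS (cond_law (law_given_n prior px ps n0) (S n0)
        (rescale b n0 (theta n0)))
     (cond_law (law_given_ndp prior px ps w g n0%:R) (S n0)
        (rescale b n0 (theta n0))) @[n0 --> \oo] --> 0.
Proof.
set P := fun n0 => law_given_n prior px ps n0.
set Q := fun n0 : nat => law_given_ndp prior px ps w g n0%:R.
rewrite -/(P _) -/(Q _).
have KS0 : KS (cond_law (P n0) (S n0) (rescale b n0 (theta n0)))
    (cond_law (Q n0) (S n0) (rescale b n0 (theta n0))) @[n0 --> \oo] --> 0.
  apply: (squeeze_cvge (f := cst 0)
      (h := fun n0 => 2%:E * (KS (P n0) (Q n0) / prob_s (P n0) (S n0)))).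
  - near=> n0; rewrite KS_ge0/=.
    have n0_gt0 : (0 < n0)%N by near: n0; exact: nbhs_infty_gt.
    apply: KS_cond_law_le.
    + exact: S_rect.
    + by move=> B; exact: rectangle_rescale.
    + by move=> B; rewrite law_given_n_ge0 law_given_n_le_prob_s.
    + by move=> B; rewrite law_given_ndp_ge0 ?law_given_ndp_le_prob_s// g_proper.
    + rewrite S_pos//=; apply: le_lt_trans (ltry 1).
      by apply: prob_s_law_le1; exact: S_rect.
    + apply: le_lt_trans (ltry 1).
      by apply: prob_s_lawdp_le1 => //; [exact: g_proper|exact: S_rect].
    (* The ratio tends to 0, hence is eventually below 1. *)
    + by near: n0; apply: (S_KS [set x | x < 1]); exact: open_ereal_lt'.
  - exact: cvg_cst.
  - by rewrite -[0](mule0 2%:E); exact: cvgeZl.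
(* Lower orthants are rectangles, so at each [y] the two distribution functions differ by at most
   the [KS] distance just shown to vanish. *)
split => // y Yy; apply: cvge_abse_sub0 (cvg_n y Yy) _.
  apply: fin_num_measure; apply: measurable_rectangle.
  exact: rectangle_lower.
apply: (squeeze_cvge (f := cst 0)) KS0; last exact: cvg_cst.
apply: nearW => n0; rewrite abse_ge0/=; apply: KS_ge.
exact: rectangle_lower.
Unshelve. all: by end_near. Qed.
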